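(* Let $L>0$, $\beta>0$ and $$A_2=\Big\{b\in L^1_{\rm loc}(\mathbb{R})\ \Big|\ b(\cdot+L)=b(\cdot),\ b\ge 0,\ \frac1L\int_0^L b^2\,dx=\beta\Big\}.$$ The constant function $b_0:=\sqrt{\beta}$ is a local maximizer of $c^*$ in $A_2$; more precisely, there exists an $\eta>0$ such that $$c^*(b_0)>c^*(b)\quad\text{for any } b\in A_2\text{ with }0<\|b_0-b\|_{L^2([0,L])}<\eta.$$
   Context: For $\lambda\in\mathbb{R}$ and a real $L$-periodic function $b\in L^1_{\rm loc}(\mathbb{R})$, $k(\lambda,b)\in\mathbb{R}$ denotes the principal eigenvalue of $-L_{\lambda,b}\psi:=-\psi''-2\lambda\psi'-(b(x)+\lambda^2)\psi$ on $\mathbb{R}/L\mathbb{Z}$, i.e. the unique real number for which $-L_{\lambda,b}\psi=k(\lambda,b)\psi$ has an $L$-periodic positive solution $\psi$. For $b\ge0$, $b\not\equiv0$, the minimal speed of pulsating traveling waves of $u_t=u_{xx}+b(x)(1-u)u$ is $c^*(b)=\min_{\lambda>0}\frac{-k(\lambda,b)}{\lambda}$. *)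

(* Defs.v *)
From HB Require Import structures.
From mathcomp Require Import all_boot all_order all_algebra.
From mathcomp Require Import all_classical all_reals all_analysis.

Set Implicit Arguments.
Unset Strict Implicit.
Unset Printing Implicit Defensive.
Import Order.TTheory GRing.Theory Num.Theory.
Import numFieldNormedType.Exports.

Local Open Scope classical_set_scope.
Local Open Scope ring_scope.

(* f is locally absolutely continuous (i.e. the continuous representative of a
   W^{1,1}_loc function) and g is its (a.e., or distributional) derivative. *)
Definition is_primitive_L1loc (R : realType) (f g : R -> R) : Prop :=
  locally_integrable setT g /\
  forall x y : R, x <= y ->
    f y - f x = Rintegral lebesgue_measure `[x, y] g.

(* psi is an L-periodic positive solution of
     - psi'' - 2 lambda psi' - (b + lambda^2) psi = k psi.
   As b is only locally integrable, psi is taken in W^{2,1}_loc: it is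
   differentiable, psi' is locally absolutely continuous with derivative psi2,
   and the equation holds almost everywhere. *)
Definition is_principal_eigenfunction (R : realType) (L lambda : R)
    (b : R -> R) (k : R) (psi : R -> R) : Prop :=
  [/\ periodic psi L,
      forall x, 0 < psi x,
      forall x, derivable psi x 1 &
      exists psi2 : R -> R,
        is_primitive_L1loc (derive1 psi) psi2 /\
        {ae (@lebesgue_measure R), forall x,
          - psi2 x - 2 * lambda * derive1 psi x - (b x + lambda ^+ 2) * psi x
          = k * psi x}].

Definition is_principal_eigenvalue (R : realType) (L lambda : R)
    (b : R -> R) (k : R) : Prop :=
  exists psi : R -> R, is_principal_eigenfunction L lambda b k psi.

(* The principal eigenvalue exists and is unique for L > 0 and L-periodic b in
   L^1_loc; the default value 0 is irrelevant there. *)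
Definition principal_eigenvalue (R : realType) (L lambda : R) (b : R -> R) : R :=
  xget 0 [set k | is_principal_eigenvalue L lambda b k].

Definition is_minimum (R : realType) (A : set R) (m : R) : Prop :=
  A m /\ lbound A m.

(* The minimum is attained when b >= 0 is not a.e. 0; the default value 0 is
   irrelevant there. *)
Definition minimal_speed (R : realType) (L : R) (b : R -> R) : R :=
  xget 0 [set c | is_minimum
    [set - principal_eigenvalue L lambda b / lambda | lambda in [set l : R | 0 < l]]
    c].

(* Elements of L^1_loc are functions up to a.e. equality, so periodicity and
   nonnegativity are required almost everywhere. *)
Definition A2 (R : realType) (L beta : R) : set (R -> R) :=
  [set b | [/\ locally_integrable setT b,
      {ae (@lebesgue_measure R), forall x, b (x + L) = b x},
      {ae (@lebesgue_measure R), forall x, 0 <= b x} &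
      ((L^-1)%:E * \int[lebesgue_measure]_(x in `[0%R, L]) (b x ^+ 2)%:E
        = beta%:E)%E]].

Definition L2norm (R : realType) (L : R) (f : R -> R) : \bar R :=
  ('N[(@lebesgue_measure R)]_(2%:E)[((EFin \o f) \_ `[0%R, L])])%E.

(* Main.v *)
(** Put s = sqrt beta and lambda = sqrt s, the minimizer of (s + l^2) / l; it is
    enough to show - k(lambda, b) < lambda^2 + s. Let h = b - s, let psi be the
    eigenfunction and v = psi' / psi, which is L-periodic, absolutely continuous,
    of mean zero, and satisfies the Riccati equation
      v' = C - h - 2 lambda v - v^2,  C = - k - lambda^2 - s.
    Integrating over a period, C L = int h + int v^2, while the constraint
    int b^2 = L beta reads int h = - int h^2 / (2 lambda^2). Multiplying the
    equation by v' gives int v'^2 <= int h^2, because int v' = int v v' =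
    int v^2 v' = 0; hence v is uniformly small when h is small in L^2.
    Multiplying by v then gives int v^2 <= (4/9) int h^2 / lambda^2, so C < 0.
    For constant b the same estimates give v = 0, hence the uniqueness of the
    principal eigenvalue. *)

Require Import Defs.
From mathcomp Require Import all_boot all_order all_algebra.
From mathcomp Require Import all_classical all_reals all_analysis.
From mathcomp Require Import measurable_realfun ring lra.
Import Order.TTheory GRing.Theory Num.Theory.
Import numFieldNormedType.Exports.
Local Open Scope classical_set_scope.
Local Open Scope ring_scope.

Section PrincipalEigenvalue.
Set Implicit Arguments.
Unset Strict Implicit.
Context {R : realType}.
Local Notation mu := (@lebesgue_measure R).
Implicit Types f g : R -> R.

(** * Locally absolutely continuous functions and their product rule *)

(** Supremum argument: let [s] be the supremum of the points where the bound from [a] holds. The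
    local bound at [s], applied from such a point just left of [s], carries the bound past [s], so
    [s] cannot stop short of [b]. *)
Lemma local_increment_le (A M : R -> R) (a b e : R) : a <= b ->
  (forall c, a <= c <= b -> exists2 d, 0 < d & forall x y,
     a <= x -> y <= b -> x <= c <= y -> c - x < d -> y - c < d ->
     `|A y - A x| <= e * (M y - M x)) ->
  `|A b - A a| <= e * (M b - M a).
Proof.
move=> ab loc.
pose S := [set x | a <= x <= b /\ `|A x - A a| <= e * (M x - M a)].
have Sa : S a by split; rewrite ?lexx//= !subrr normr0 mulr0.
have ubS : ubound S b by move=> x [/andP[]].
have hS : has_sup S by split; [exists a | exists b].
set s := sup S.
have as_ : a <= s by apply: ub_le_sup => //; exists b.
have sb : s <= b by apply: ge_sup => //; exists a.
have [|d d0 hd] := loc s; first by rewrite as_ sb.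
have [x Sx sx] := sup_adherent d0 hS; rewrite -/s in sx.
have xs : x <= s by apply: ub_le_sup => //; exists b.
case: Sx => /andP[ax xb] Ax.
have Sy y : s <= y -> y <= b -> y - s < d -> S y.
  move=> sy yb ysd; split; first by rewrite yb (le_trans as_).
  have := hd x y ax yb; rewrite xs sy ltrBlDr -ltrBlDl sx => /(_ isT isT ysd) Axy.
  have -> : A y - A a = (A y - A x) + (A x - A a) by ring.
  have -> : e * (M y - M a) = e * (M y - M x) + e * (M x - M a) by ring.
  exact: le_trans (ler_normD _ _) (lerD Axy Ax).
have [sdb|bsd] := leP (s + d / 2) b.
  have : S (s + d / 2) by apply: Sy => //; lra.
  have d2 : 0 < d / 2 by lra.
  move=> Ss; have := ub_le_sup (ex_intro _ b ubS) Ss; rewrite -/s; lra.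
by have [] : S b by apply: Sy => //; lra.
Qed.

Definition itv_integrable f :=
  forall x y : R, mu.-integrable `[x, y] (EFin \o f).

(** Local absolute continuity of [f] with almost everywhere derivative [f'], encoded by the integral
    identity so that [f'] may be merely integrable on segments. *)
Definition is_primitive f f' := itv_integrable f' /\
  forall x y : R, x <= y -> f y - f x = \int[mu]_(t in `[x, y]) f' t.

Lemma locally_integrable_itv f : locally_integrable setT f -> itv_integrable f.
Proof.
move=> [mf _ If] x y; apply/integrableP; split.
  by apply/measurable_EFinP; exact: measurable_funTS.
by apply: If => //; exact: segment_compact.
Qed.

Lemma continuous_itv_integrable f : continuous f -> itv_integrable f.
Proof.
move=> cf x y; apply: continuous_compact_integrable; first exact: segment_compact.
exact: continuous_subspaceT.
Qed.

Lemma itv_integrable_cM f g :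
  continuous f -> itv_integrable g -> itv_integrable (fun x => f x * g x).
Proof.
move=> cf ig x y.
apply: (@integrableMr _ _ _ mu _ _ f (EFin \o g)) => //.
  by apply: measurable_funTS; exact: continuous_measurable_fun.
have [M [Mr MP]] : bounded_set (f @` `[x, y]).
  apply: compact_bounded; apply: continuous_compact; last exact: segment_compact.
  exact: continuous_subspaceT.
by exists M; split => // K MK z xz; apply: (MP K MK); exists z.
Qed.

Lemma itv_integrableD f g :
  itv_integrable f -> itv_integrable g -> itv_integrable (fun x => f x + g x).
Proof. by move=> fi gi x y; exact: (integrableD _ (fi x y) (gi x y)). Qed.

Lemma itv_integrable_norm f : itv_integrable f -> itv_integrable (fun x => `|f x|).
Proof. by move=> fi x y; exact: integrable_norm. Qed.

Lemma Rintegral_itv_cat f (a x y : R) : itv_integrable f -> a <= x -> x <= y ->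
  \int[mu]_(t in `[a, y]) f t - \int[mu]_(t in `[a, x]) f t =
  \int[mu]_(t in `[x, y]) f t.
Proof.
move=> fi ax xy; rewrite Rintegral_itvB//.
rewrite Rintegral_itv_obnd_cbnd//.
by apply: integrableS (fi x y) => //; exact: subset_itv_oc_cc.
Qed.

Lemma is_primitive_continuous f f' : is_primitive f f' -> continuous f.
Proof.
move=> [f'i ff'] c.
have ab : c - 1 < c + 1 by lra.
have /(continuous_within_itvP _ ab)[+ _ _] :=
  parameterized_integral_continuous (ltW ab) (f'i _ _).
have cab : c \in `]c - 1, c + 1[ by rewrite in_itv/=; lra.
move=> /(_ c cab) cint.
have fE x : c - 1 <= x -> f x = f (c - 1) + \int[mu]_(t in `[c - 1, x]) f' t.
  by move=> /ff' <-; rewrite subrKC.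
rewrite /continuous_at [X in _ --> X]fE; last lra.
apply: cvg_trans (cvgD (cvg_cst (f (c - 1))) cint).
apply: near_eq_cvg; near=> x; rewrite /= [RHS]fE//.
by near: x; apply: lt_le_nbhsr; lra.
Unshelve. all: by end_near. Qed.


(* On a short interval around c, the increment of f g differs from the integral
   of g f' + f g' by at most e times the integral of |f'| + |g'|. *)
Lemma is_primitiveM f f' g g' : is_primitive f f' -> is_primitive g g' ->
  is_primitive (fun x => f x * g x) (fun x => g x * f' x + f x * g' x).
Proof.
move=> pf pg.
have cf := is_primitive_continuous pf; have cg := is_primitive_continuous pg.
case: pf pg => [f'i ff'] [g'i gg'].
set w := (X in is_primitive _ X).
have wi : itv_integrable w.
  by apply: itv_integrableD; exact: itv_integrable_cM.
split=> // a b ab.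
(* [A] is the defect in the product formula. It is shown to have zero increment, since its
   increments are at most [e] times those of [M] for every [e > 0]. *)
pose A x := f x * g x - \int[mu]_(t in `[a, x]) w t.
pose m x := `|f' x| + `|g' x|.
pose M x := \int[mu]_(t in `[a, x]) m t.
have mi : itv_integrable m by apply: itv_integrableD; exact: itv_integrable_norm.
have Ae (e : R) : 0 < e -> `|A b - A a| <= e * (M b - M a).
  move=> e0; apply: local_increment_le => // c /andP[ac cb].
  have e2 : 0 < e / 2 by lra.
  have /cvgrPdist_lt/(_ _ e2)[d1 /= d10 hd1] := cf c.
  have /cvgrPdist_lt/(_ _ e2)[d2 /= d20 hd2] := cg c.
  exists (Num.min d1 d2); first by rewrite lt_min d10.
  move=> x y ax yb /andP[xc cy]; rewrite !lt_min => /andP[xd1 xd2] /andP[yd1 yd2].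
  have xy := le_trans xc cy.
  have osc t : t \in `[x, y] -> `|f y - f t| <= e /\ `|g x - g t| <= e.
    rewrite in_itv/= => /andP[xt ty].
    have near1 z : x <= z -> z <= y -> `|f c - f z| < e / 2 /\ `|g c - g z| < e / 2.
      move=> xz zy; split; [apply: hd1|apply: hd2].
        by rewrite /ball_/= ltr_norml; apply/andP; split; lra.
      by rewrite /ball_/= ltr_norml; apply/andP; split; lra.
    have [ft gt] := near1 t xt ty.
    have [fy _] := near1 y xy (lexx _).
    have [_ gx] := near1 x (lexx _) xy.
    split.
      have -> : f y - f t = (f c - f t) - (f c - f y) by ring.
      by apply: le_trans (ler_normB _ _) _; lra.
    have -> : g x - g t = (g c - g t) - (g c - g x) by ring.
    by apply: le_trans (ler_normB _ _) _; lra.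
  (* Discrete product rule: the increments of [f] and [g] become integrals, so only the oscillations
     [f y - f t] and [g x - g t] remain as factors. *)
  have -> : A y - A x = f y * (g y - g x) + g x * (f y - f x) -
      (\int[mu]_(t in `[a, y]) w t - \int[mu]_(t in `[a, x]) w t).
    by rewrite /A; ring.
  rewrite /M !Rintegral_itv_cat// ff'// gg'//.
  have ci (r : R) h : itv_integrable h -> itv_integrable (fun t => r * h t).
    by apply: itv_integrable_cM; exact: cst_continuous.
  rewrite -!RintegralZl//.
  rewrite -RintegralD//; [|exact: ci|exact: ci].
  have di : itv_integrable (fun t => f y * g' t + g x * f' t).
    by apply: itv_integrableD; exact: ci.
  rewrite -RintegralB//.
  have dwi : mu.-integrable `[x, y]
      (EFin \o (fun t => f y * g' t + g x * f' t - w t)).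
    exact: (integrableB _ (di x y) (wi x y)).
  apply: le_trans (le_normr_Rintegral _ _) _ => //.
  apply: le_Rintegral => //; [exact: integrable_norm|exact: ci|].
  move=> t /osc[oft ogt].
  have -> : f y * g' t + g x * f' t - w t = (f y - f t) * g' t + (g x - g t) * f' t.
    by rewrite /w; ring.
  apply: le_trans (ler_normD _ _) _; rewrite !normrM /m mulrDr addrC.
  by apply: lerD; apply: ler_wpM2r.
have MA : 0 <= M b - M a.
  rewrite /M Rintegral_itv_cat//; apply: Rintegral_ge0 => t _.
  by rewrite /m addr_ge0.
have : `|A b - A a| <= 0.
  apply/ler_addgt0Pl => e e0; rewrite addr0.
  (* The added 1 keeps the denominator positive when [M b = M a]. *)
  have := Ae (e / (M b - M a + 1)); rewrite divr_gt0//; last by lra.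
  move=> /(_ isT) /le_trans; apply.
  by rewrite mulrAC ler_pdivrMr; [nra|lra].
rewrite normr_le0 /A subr_eq0 => /eqP.
rewrite [\int[mu]_(t in `[a, a]) _](_ : _ = 0); last first.
  by rewrite set_itv1 Rintegral_set1.
by move=> h; lra.
Qed.

Lemma is_primitive_ae f g h : is_primitive f g -> itv_integrable h ->
  {ae mu, forall x, g x = h x} -> is_primitive f h.
Proof.
move=> [gi fg] hi gh; split=> // x y xy; rewrite fg//; congr fine.
apply: ae_eq_integral => //.
- exact: measurable_int (gi x y).
- exact: measurable_int (hi x y).
- case: gh => N [mN N0 NP]; exists N; split=> // t nt; apply: NP => /= ght.
  by apply: nt => /= _; rewrite ght.
Qed.

Lemma is_derive_is_primitive f g : (forall x : R, is_derive x 1 f (g x)) ->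
  continuous g -> is_primitive f g.
Proof.
move=> df cg; split; first exact: continuous_itv_integrable.
have cf : continuous f.
  by move=> x; apply/differentiable_continuous/derivable1_diffP; case: (df x).
move=> x y; rewrite le_eqVlt => /predU1P[<-|xy].
  by rewrite set_itv1 Rintegral_set1 subrr.
rewrite /Rintegral (continuous_FTC2 (F := f) xy)//.
- exact: continuous_subspaceT.
- split=> [z _| |]; first by case: (df z).
  + exact/cvg_at_right_filter/cf.
  + exact/cvg_at_left_filter/cf.
- by move=> z _; rewrite derive1E; case: (df z).
Qed.

(** * The Riccati equation of the logarithmic derivative *)

Lemma periodic_derive1 (f : R -> R) (L : R) :
  periodic f L -> periodic (derive1 f) L.
Proof.
move=> pf x; rewrite /derive1; under eq_fun do rewrite addrA !pf.
by [].
Qed.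

(** The equation is the product rule for [psi'] times [1 / psi]. The mean vanishes because [v] is
    the derivative of the periodic function [ln psi], and the zero is a critical point of [psi]
    given by Rolle. *)
Lemma log_derivative_riccati (L lambda k : R) (b psi : R -> R) : 0 < L ->
  locally_integrable setT b -> is_principal_eigenfunction L lambda b k psi ->
  let v (x : R) : R := derive1 psi x / psi x in
  [/\ is_primitive v
        (fun x => - k - lambda ^+ 2 - b x - 2 * lambda * v x - v x ^+ 2),
      v L = v 0, \int[mu]_(x in `[0, L]) v x = 0 &
      exists2 x0, 0 <= x0 <= L & v x0 = 0].
Proof.
move=> L0 /locally_integrable_itv bi [per pos dpsi [psi2 [[psi2i psi2P] eqn]]] v.
set p : R -> R := derive1 psi.
have pp2 : is_primitive p psi2 by split => //; exact: locally_integrable_itv.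
have cp := is_primitive_continuous pp2.
have cpsi : continuous psi.
  by move=> x; apply/differentiable_continuous/derivable1_diffP.
have psi_neq0 x : psi x != 0 by rewrite gt_eqF.
have cpsiV : continuous (fun x => (psi x)^-1).
  by move=> x; apply: cvgV => //; exact: cpsi.
have cv : continuous v by move=> x; apply: cvgM; [exact: cp|exact: cpsiV].
have dpsiE (x : R) : is_derive x 1 psi (p x).
  by apply: DeriveDef => //; rewrite /p derive1E.
have cst_i (r : R) : itv_integrable (fun=> r).
  by apply: continuous_itv_integrable; exact: cst_continuous.
(* The equation solved for the second derivative replaces [psi2] by an explicit density that agrees
   with it almost everywhere. *)
have pp : is_primitive p
    (fun x => - (2 * lambda * p x) - (b x + lambda ^+ 2 + k) * psi x).
  apply: (is_primitive_ae pp2).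
    have -> : (fun x => - (2 * lambda * p x) - (b x + lambda ^+ 2 + k) * psi x) =
      (fun x => (- (2 * lambda)) * p x + (- psi x) * (b x + (lambda ^+ 2 + k))).
      by apply/funext => x; ring.
    apply: itv_integrableD.
      apply: itv_integrable_cM; first exact: cst_continuous.
      exact: continuous_itv_integrable.
    apply: itv_integrable_cM; first by move=> x; apply: cvgN; exact: cpsi.
    exact: itv_integrableD.
  case: eqn => N [mN N0 NP]; exists N; split => // t nt; apply: NP => /= tE.
  by apply: nt => /=; move: tE; rewrite -/p; lra.
have pV : is_primitive (fun x => (psi x)^-1) (fun x => - (psi x)^-1 ^+ 2 * p x).
  apply: is_derive_is_primitive => [x|].
    have -> : - (psi x)^-1 ^+ 2 * p x = - (psi x) ^- 2 *: p x.
      by rewrite exprVn.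
    exact: is_deriveV.
  move=> x; apply: cvgM; last exact: cp.
  by apply: cvgN; under eq_fun do rewrite expr2; apply: cvgM; exact: cpsiV.
have vL : v L = v 0.
  by rewrite /v -[L in LHS]add0r (periodic_derive1 per) per.
split=> //.
- have := is_primitiveM pp pV.
  congr (is_primitive _ _); apply/funext => x; rewrite /v -/p.
  by field.
- have [_ <-] : is_primitive (@ln R \o psi) v.
  + apply: is_derive_is_primitive => // x.
    have dln := is_derive1_ln (pos x).
    by rewrite /v mulrC; exact: is_derive1_comp.
  + by rewrite /= -[L]add0r per subrr.
  + exact: ltW.
- have [|c] := Rolle L0 (fun x _ => dpsi x) (continuous_subspaceT cpsi).
    by rewrite -[L]add0r per.
  rewrite in_itv/= => /andP[/ltW c0 /ltW cL] [_ dc].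
  by exists c; rewrite ?c0// /v derive1E dc mul0r.
Qed.

(** * Integral estimates for periodic Riccati solutions *)

(** Returning integrability along with the value lets linear combinations be integrated one term at
    a time by chaining. *)
Lemma Rintegral_axpy {d} {T : measurableType d} {m : {measure set T -> \bar R}}
    (D : set T) (c : R) (f g : T -> R) :
  measurable D -> m.-integrable D (EFin \o f) -> m.-integrable D (EFin \o g) ->
  m.-integrable D (EFin \o (fun x => c * f x + g x)) /\
  \int[m]_(x in D) (c * f x + g x) =
    c * \int[m]_(x in D) f x + \int[m]_(x in D) g x.
Proof.
move=> mD fi gi.
have cfi : m.-integrable D (EFin \o (fun x => c * f x)).
  exact: (integrableZl mD c fi).
split; first exact: (integrableD mD cfi gi).
by rewrite RintegralD// RintegralZl.
Qed.

(** The three bounds come from testing the equation against 1, [v'] and [v]. The free weight [a]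
    comes from bounding [|v'|] by [a / 2 + v'^2 / (2 a)]; the zero [x0] turns the bound on the
    integral of [|v'|] into one on [|v|]. *)
Lemma riccati_estimates (L lambda C : R) (h v : R -> R) : 0 < L ->
  is_primitive v (fun x => C - h x - 2 * lambda * v x - v x ^+ 2) ->
  itv_integrable h -> mu.-integrable `[0, L] (EFin \o (fun x => h x ^+ 2)) ->
  v L = v 0 -> \int[mu]_(x in `[0, L]) v x = 0 ->
  (exists2 x0, 0 <= x0 <= L & v x0 = 0) ->
  [/\ C * L = \int[mu]_(x in `[0, L]) h x + \int[mu]_(x in `[0, L]) (v x ^+ 2),
      forall a x, 0 < a -> 0 <= x <= L ->
        `|v x| <= a * L / 2 + \int[mu]_(x in `[0, L]) (h x ^+ 2) / (2 * a) &
      0 < lambda -> (forall x, 0 <= x <= L -> `|v x| <= lambda / 2) ->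
        9 * lambda ^+ 2 * \int[mu]_(x in `[0, L]) (v x ^+ 2) <=
        4 * \int[mu]_(x in `[0, L]) (h x ^+ 2)].
Proof.
move=> L0 pv hi h2i vL Iv [x0 /andP[x00 x0L] vx0].
set w := (X in is_primitive v X) in pv.
have L0' := ltW L0.
have cv := is_primitive_continuous pv.
have wi := pv.1.
have pv2 := is_primitiveM pv pv.
have pv3 := is_primitiveM pv2 pv.
have cv2 : continuous (fun x => v x ^+ 2).
  exact: (is_primitive_continuous pv2).
have vwi := itv_integrable_cM cv wi.
have v2wi := itv_integrable_cM cv2 wi.
have vi := continuous_itv_integrable cv.
have v2i := continuous_itv_integrable cv2.
have ci (r : R) : mu.-integrable `[0, L] (EFin \o (fun=> r)).
  by apply: continuous_itv_integrable; exact: cst_continuous.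
have Icst (r : R) : \int[mu]_(x in `[0, L]) r = r * L.
  rewrite Rintegral_cst//= lebesgue_measure_itv/= lte_fin L0/=.
  by rewrite subr0.
have mI : measurable (`[0, L]%classic : set (measurableTypeR R)) by [].
(* The next three integrals are the increments of [v], [v^2 / 2] and [v^3 / 3] over a period. *)
have Iw : \int[mu]_(x in `[0, L]) w x = 0.
  by rewrite -(pv.2 _ _ L0') vL subrr.
have Ivw : \int[mu]_(x in `[0, L]) (v x * w x) = 0.
  by have := pv2.2 _ _ L0'; rewrite vL subrr RintegralD//; lra.
have Iv2w : \int[mu]_(x in `[0, L]) (v x ^+ 2 * w x) = 0.
  have := pv3.2 _ _ L0'; rewrite vL subrr.
  rewrite [RHS](@eq_Rintegral _ _ _ mu _ (fun x => 3 * (v x ^+ 2 * w x))).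
    by rewrite RintegralZl//; lra.
  by move=> x _; ring.
split.
- have [i1 e1] := Rintegral_axpy (-1) mI (v2i 0 L) (ci C).
  have [i2 e2] := Rintegral_axpy (- (2 * lambda)) mI (vi 0 L) i1.
  have [_ e3] := Rintegral_axpy (-1) mI (hi 0 L) i2.
  move: e3; rewrite e2 e1 Icst Iv [LHS](@eq_Rintegral _ _ _ mu _ w); first by rewrite Iw; lra.
  by move=> x _; rewrite /w; ring.
- move=> a x a0 /andP[x0' xL].
  (* The majorant of [|w|] is [a / 2 + h^2 / (2 a) + (C - 2 lambda v - v^2) w / a], whose last term
     integrates to zero. *)
  have [i1 e1] := Rintegral_axpy (2 * a)^-1 mI h2i (ci (a / 2)).
  have [i2 e2] := Rintegral_axpy (C / a) mI (wi 0 L) i1.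
  have [i3 e3] := Rintegral_axpy (- (2 * lambda) / a) mI (vwi 0 L) i2.
  have [i4 e4] := Rintegral_axpy (- a^-1) mI (v2wi 0 L) i3.
  have nwi := itv_integrable_norm wi.
  have Inw : \int[mu]_(x in `[0, L]) `|w x| <=
      a * L / 2 + \int[mu]_(x in `[0, L]) (h x ^+ 2) / (2 * a).
    apply: (le_trans (le_Rintegral mI (nwi 0 L) i4 _)).
      move=> t _.
      (* AM-GM, and w^2 <= h^2 + 2 w (w + h) where w + h is a polynomial in v. *)
      rewrite [leRHS](_ : _ = a / 2 + w t ^+ 2 / (2 * a) +
          (w t + h t) ^+ 2 / (2 * a)); last first.
        have -> : h t = C - 2 * lambda * v t - v t ^+ 2 - w t.
          by rewrite /w; ring.
        by field; rewrite gt_eqF.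
      have -> : a / 2 + w t ^+ 2 / (2 * a) = `|w t| + (`|w t| - a) ^+ 2 / (2 * a).
        rewrite -[in LHS]real_normK ?num_real//.
        by field; rewrite gt_eqF.
      by rewrite -addrA lerDl addr_ge0// divr_ge0 ?sqr_ge0//; lra.
    by rewrite e4 e3 e2 e1 Iw Ivw Iv2w Icst; lra.
  have subI y z : 0 <= y -> y <= z -> z <= L ->
      `|v z - v y| <= \int[mu]_(x in `[0, L]) `|w x|.
    move=> y0 yz zL; rewrite (pv.2 _ _ yz).
    apply: le_trans (le_normr_Rintegral _ (wi y z)) _ => //.
    have A1 := Rintegral_itv_cat nwi y0 yz.
    have A2 := Rintegral_itv_cat nwi (le_trans y0 yz) zL.
    have B1 : 0 <= \int[mu]_(x in `[0, y]) `|w x| by exact: Rintegral_ge0.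
    have B2 : 0 <= \int[mu]_(x in `[z, L]) `|w x| by exact: Rintegral_ge0.
    by move: A1 A2 B1 B2; clear; lra.
  apply: le_trans Inw.
  have [xx0|/ltW x0x] := leP x x0.
    by have := subI x x0 x0' xx0 x0L; rewrite vx0 sub0r normrN.
  by have := subI x0 x x00 x0x xL; rewrite vx0 subr0.
- move=> l0 vle.
  (* Here [- h v <= h^2 / (3 lambda) + (3 lambda / 4) v^2] and [- v^3 <= (lambda / 2) v^2]; with
     [- 2 lambda v^2] this leaves [- (3 lambda / 4) v^2]. This weight gives the best ratio, 4/9. *)
  have [i1 e1] := Rintegral_axpy (- (3 * lambda / 4)) mI (v2i 0 L) (ci 0).
  have [i2 e2] := Rintegral_axpy (3 * lambda)^-1 mI h2i i1.
  have [i3 e3] := Rintegral_axpy C mI (vi 0 L) i2.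
  have : 0 <= C * 0 + ((3 * lambda)^-1 * \int[mu]_(x in `[0, L]) (h x ^+ 2) +
     (- (3 * lambda / 4) * \int[mu]_(x in `[0, L]) (v x ^+ 2) + 0 * L)).
    move: e3; rewrite e2 e1 Icst Iv => <-; rewrite -[leLHS]Ivw.
    apply: le_Rintegral (vwi 0 L) i3 _ => // t.
    rewrite /= in_itv/= => /vle vt.
    rewrite -subr_ge0 [leRHS](_ : _ = (3 * lambda)^-1 * (h t + 3 * lambda / 2 * v t) ^+ 2
       + (lambda / 2 + v t) * v t ^+ 2); last first.
      by rewrite /w; field; rewrite gt_eqF.
    rewrite addr_ge0// mulr_ge0 ?sqr_ge0 ?invr_ge0//; first lra.
    by move: vt; rewrite ler_norml => /andP[]; lra.
  set H2 := (X in _^-1 * X); set V2 := (X in _ * X + 0 * L) => H.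
  suff : 9 * lambda ^+ 2 * V2 <= 4 * H2 by [].
  rewrite -subr_ge0 [leRHS](_ : _ = (12 * lambda) *
      (C * 0 + ((3 * lambda)^-1 * H2 + (- (3 * lambda / 4) * V2 + 0 * L)))).
    by apply: mulr_ge0 => //; lra.
  by field; rewrite gt_eqF.
Qed.

(** * Consequences for the principal eigenvalue *)

(** The Riccati estimates with [h = b - s], where [V] stands for the integral of [v^2]. The
    condition on [a] forces [|v| <= lambda / 2]. *)
Lemma principal_eigenvalue_estimates (L lambda k s : R) (b : R -> R) : 0 < L ->
  locally_integrable setT b ->
  mu.-integrable `[0, L] (EFin \o (fun x => (b x - s) ^+ 2)) ->
  is_principal_eigenvalue L lambda b k ->
  exists V : R, [/\ 0 <= V,
    (- k - lambda ^+ 2 - s) * L = \int[mu]_(x in `[0, L]) (b x - s) + V &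
    forall a, 0 < a -> 0 < lambda ->
      a * L / 2 + \int[mu]_(x in `[0, L]) ((b x - s) ^+ 2) / (2 * a)
        <= lambda / 2 ->
      9 * lambda ^+ 2 * V <= 4 * \int[mu]_(x in `[0, L]) ((b x - s) ^+ 2)].
Proof.
move=> L0 lb h2i [psi psiP].
have [pv vL Iv vx0] := log_derivative_riccati L0 lb psiP.
set v := (fun x : R => derive1 psi x / psi x) in pv vL Iv vx0 *.
have hi : itv_integrable (fun x => b x - s).
  apply: itv_integrableD; first exact: locally_integrable_itv.
  by apply: continuous_itv_integrable; exact: cst_continuous.
have pv' : is_primitive v
    (fun x => (- k - lambda ^+ 2 - s) - (b x - s) - 2 * lambda * v x - v x ^+ 2).
  by move: pv; congr (is_primitive _ _); apply/funext => x; rewrite -/(v x); ring.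
have [E1 E2 E3] := riccati_estimates L0 pv' hi h2i vL Iv vx0.
exists (\int[mu]_(x in `[0, L]) (v x ^+ 2)); split=> //.
  by apply: Rintegral_ge0 => x _; exact: sqr_ge0.
move=> a a0 l0 aL; apply: E3 => // x xL.
exact: le_trans (E2 _ _ a0 xL) aL.
Qed.

(** * Eigenvalue and speed for a constant coefficient *)

Lemma locally_integrable_cst (s : R) : locally_integrable setT (fun _ : R => s).
Proof.
split => // [|K _ cK]; first exact: openT.
rewrite integral_cst//; last exact: compact_measurable.
by apply: lte_mul_pinfty => //; exact: compact_finite_measure.
Qed.

(** The eigenfunction is 1. For uniqueness, [h = 0] forces [V = 0], and then [C L = V] fixes [k]. *)
Lemma principal_eigenvalue_cst (L lambda s : R) : 0 < L -> 0 < lambda ->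
  principal_eigenvalue L lambda (fun=> s) = - (s + lambda ^+ 2).
Proof.
move=> L0 l0; apply: xget_unique => [|k kP].
  exists (fun=> 1); split=> //.
  exists (fun=> 0); split.
    split; first exact: locally_integrable_cst.
    move=> x y xy; rewrite /derive1.
    by rewrite Rintegral_cst// mul0r; under eq_fun do rewrite subrr scaler0; rewrite subrr.
  exists set0; split=> // x; apply: contraPP => _ /=; apply; rewrite derive1_cst; ring.
have lb := locally_integrable_cst s.
have h0 : (fun _ : R => (s - s) ^+ 2) = (fun=> 0) by rewrite subrr expr0n.
have [|V [V0 CV VL]] := principal_eigenvalue_estimates (s := s) L0 lb _ kP.
  rewrite h0.
  by apply: continuous_itv_integrable; exact: cst_continuous.
(* With [h = 0], the weight [a = lambda / L] gives exactly the admissible bound [lambda / 2]. *)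
have lL : 0 < lambda / L by rewrite divr_gt0.
have := VL _ lL l0; rewrite h0 Rintegral_cst// mul0r.
have := CV; rewrite subrr Rintegral_cst// mul0r add0r mulr0.
move=> CV' VL'; have {}VL' : 9 * lambda ^+ 2 * V <= 0.
  by apply: VL'; rewrite mul0r divfK ?gt_eqF//; lra.
have l2 : 0 < 9 * lambda ^+ 2 by rewrite mulr_gt0// exprn_gt0.
have V00 : V = 0.
  by apply/eqP; rewrite eq_le V0 andbT -(pmulr_rle0 _ l2).
move/eqP: CV'; rewrite V00 mulf_eq0 [L == 0]gt_eqF// orbF => /eqP; lra.
Qed.

(** The gap [(lambda^2 + l^2) / l - 2 lambda] equals [(lambda - l)^2 / l], so the minimum is at
    [l = lambda]. *)
Lemma minimal_speed_cst (L lambda : R) : 0 < L -> 0 < lambda ->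
  minimal_speed L (fun=> lambda ^+ 2) = 2 * lambda.
Proof.
move=> L0 l0.
have speedE l : 0 < l ->
    - principal_eigenvalue L l (fun=> lambda ^+ 2) / l = (lambda ^+ 2 + l ^+ 2) / l.
  by move=> ?; rewrite principal_eigenvalue_cst// opprK.
have minP : is_minimum
    [set - principal_eigenvalue L l (fun=> lambda ^+ 2) / l | l in [set l : R | 0 < l]]
    (2 * lambda).
  split; first by exists lambda => //; rewrite speedE//; field; rewrite gt_eqF.
  move=> _ [l /= lgt0 <-]; rewrite speedE// ler_pdivlMr// -subr_ge0.
  by rewrite [leRHS](_ : _ = (lambda - l) ^+ 2) ?sqr_ge0//; ring.
apply: xget_unique => // c [cA clb]; case: minP => mA mlb.
by apply/eqP; rewrite eq_le clb// mlb.
Qed.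

(** * The norm and the quadratic constraint *)

Lemma sqr_L2norm (L n : R) (f : R -> R) :
  mu.-integrable `[0, L] (EFin \o (fun x => f x ^+ 2)) ->
  L2norm L f = n%:E -> n ^+ 2 = \int[mu]_(x in `[0, L]) (f x ^+ 2).
Proof.
move=> f2i fn; have n0 : 0 <= n by rewrite -lee_fin -fn; exact: Lnorm_ge0.
apply: EFin_inj; rewrite -powR_mulrn// -poweR_EFin -fn /L2norm powR_Lnorm//.
rewrite [RHS]fineK; last exact: integrable_fin_num.
rewrite [RHS]integral_mkcond; apply: eq_integral => x _.
rewrite !patchE; case: ifPn => _ /=.
  by rewrite powR_mulrn// real_normK ?num_real.
by rewrite normr0 powR0.
Qed.

Lemma A2_sqr_integrable (L beta s : R) (b : R -> R) : 0 < L -> A2 L beta b ->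
  mu.-integrable `[0, L] (EFin \o (fun x => (b x - s) ^+ 2)) /\
  \int[mu]_(x in `[0, L]) ((b x - s) ^+ 2) =
    L * beta - 2 * s * \int[mu]_(x in `[0, L]) b x + s ^+ 2 * L.
Proof.
move=> L0 [lb _ _ b2].
(* The constraint is an equality of extended reals with a finite right side and a positive factor,
   so it also excludes infinite values. *)
have Ib2 : (\int[mu]_(x in `[0%R, L]) (b x ^+ 2)%:E = (L * beta)%:E)%E.
  move: b2; set I := (X in (_ * X)%E = _); rewrite -/I; case: I => [r| |] /=.
  - by case=> <-; congr _%:E; field; rewrite gt_eqF.
  - by rewrite gt0_muley// lte_fin invr_gt0.
  - by rewrite gt0_muleNy// lte_fin invr_gt0.
have mI : measurable (`[0, L]%classic : set (measurableTypeR R)) by [].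
have mb : measurable_fun (`[0, L]%classic : set (measurableTypeR R)) b.
  by case: lb => mb _ _; exact: measurable_funTS.
have b2i : mu.-integrable `[0, L] (EFin \o (fun x => b x ^+ 2)).
  apply/integrableP; split; first by apply/measurable_EFinP; exact: measurable_funX.
  under eq_integral do rewrite /= ger0_norm ?sqr_ge0//.
  by rewrite Ib2 ltry.
have bi := locally_integrable_itv lb.
have ci : mu.-integrable `[0, L] (EFin \o (fun=> s ^+ 2)).
  by apply: continuous_itv_integrable; exact: cst_continuous.
have [i1 e1] := Rintegral_axpy (- (2 * s)) mI (bi 0 L) ci.
have [i2 e2] := Rintegral_axpy 1 mI b2i i1.
have -> : (fun x => (b x - s) ^+ 2) =
    (fun x => 1 * b x ^+ 2 + (- (2 * s) * b x + s ^+ 2)).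
  by apply/funext => x; ring.
split=> //; rewrite e2 e1 {1}/Rintegral Ib2/= Rintegral_cst//=.
rewrite lebesgue_measure_itv/= lte_fin L0/= subr0; ring.
Qed.

End PrincipalEigenvalue.

(** * Strict local maximality of the constant coefficient *)

Theorem theorem2p8 (R : realType) (L beta : R) (hL : 0 < L) (hbeta : 0 < beta) :
  let b0 : R -> R := fun=> Num.sqrt beta in
  A2 L beta b0 /\
  exists eta : R, 0 < eta /\
    forall b : R -> R, A2 L beta b ->
      (0 < L2norm L (b0 \- b)%R)%E -> (L2norm L (b0 \- b)%R < eta%:E)%E ->
      minimal_speed L b0 > minimal_speed L b.
Proof.
move=> b0; split.
  split.
  - exact: locally_integrable_cst.
  - exact: aeW.
  - by apply: aeW => x; exact: sqrtr_ge0.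
  - have -> : (fun x => (b0 x ^+ 2)%:E) = cst beta%:E.
      by apply/funext => x; rewrite /b0 sqr_sqrtr// ltW.
    rewrite integral_cst//= lebesgue_measure_itv/= lte_fin hL.
    rewrite -EFinB subr0 -!EFinM; congr _%:E.
    by field; rewrite gt_eqF.
set s := Num.sqrt beta; set lambda := Num.sqrt s.
have s0 : 0 < s by rewrite sqrtr_gt0.
have l0 : 0 < lambda by rewrite sqrtr_gt0.
have sE : s = lambda ^+ 2 by rewrite sqr_sqrtr// ltW.
have betaE : beta = s ^+ 2 by rewrite sqr_sqrtr// ltW.
have sL0 : 0 < Num.sqrt L by rewrite sqrtr_gt0.
(* This radius gives [H2 <= lambda^2 / (4 L)]. With [a = lambda / (2 L)], the bound on [|v|] is then
   [lambda / 4 + H2 L / lambda <= lambda / 2]. *)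
exists (lambda / (2 * Num.sqrt L)); split; first by rewrite divr_gt0// mulr_gt0.
move=> b bA2 N0 Neta.
rewrite [ltRHS](_ : _ = 2 * lambda); last by rewrite /b0 -/s sE minimal_speed_cst.
have [h2i h2E] := A2_sqr_integrable s hL bA2.
have lb : locally_integrable setT b by case: bA2.
set H2 := \int[lebesgue_measure]_(x in `[0, L]) _ in h2E.
have fE : (fun x => (b0 \- b) x ^+ 2) = (fun x => (b x - s) ^+ 2).
  by apply/funext => x; rewrite /= /b0 -/s; ring.
have [H20 H2small] : 0 < H2 /\ H2 <= lambda ^+ 2 / (4 * L).
  move: N0 Neta; case E : (L2norm L (b0 \- b)) => [n| |]//.
  rewrite !lte_fin => n0 neta.
  have H2E : H2 = n ^+ 2 by rewrite (sqr_L2norm _ E) fE.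
  rewrite H2E; split; first by rewrite exprn_gt0.
  have -> : lambda ^+ 2 / (4 * L) = (lambda / (2 * Num.sqrt L)) ^+ 2.
    rewrite -[L in LHS]sqr_sqrtr ?ltW//; field.
    by rewrite gt_eqF.
  by apply: lerXn2r; rewrite ?nnegrE ltW// divr_gt0// mulr_gt0.
(* If b has no principal eigenvalue or no minimal speed, the junk value is 0,
   which lies below 2 lambda: existence for b is never needed. *)
have speed_lt : - principal_eigenvalue L lambda b / lambda < 2 * lambda.
  rewrite ltr_pdivrMr//.
  rewrite /principal_eigenvalue; case: xgetP => [k _ kP|_]; last first.
    by rewrite oppr0 !mulr_gt0.
  have [V [V0 CV VL]] := principal_eigenvalue_estimates hL lb h2i kP.
  have {}VL : 9 * lambda ^+ 2 * V <= 4 * H2.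
    apply: (VL (lambda / (2 * L))) => //; first by rewrite divr_gt0// mulr_gt0.
    rewrite -/H2.
    have -> : lambda / (2 * L) * L / 2 + H2 / (2 * (lambda / (2 * L))) =
              lambda / 4 + H2 * (L / lambda) by field; rewrite !gt_eqF.
    have -> : lambda / 2 = lambda / 4 + lambda ^+ 2 / (4 * L) * (L / lambda).
      by field; rewrite !gt_eqF.
    by rewrite lerD2l ler_wpM2r// divr_ge0// ltW.
  have Ibs : \int[@lebesgue_measure R]_(x in `[0, L]) (b x - s) =
      \int[@lebesgue_measure R]_(x in `[0, L]) b x - s * L.
    rewrite RintegralB//.
    - rewrite Rintegral_cst//= lebesgue_measure_itv/= lte_fin hL/=.
      by rewrite subr0.
    - exact: locally_integrable_itv.
    - exact: locally_integrable_itv (locally_integrable_cst s) _ _.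
  have CL : (- k - lambda ^+ 2 - s) * L < 0.
    (* The constraint reads [H2 = - 2 lambda^2 (B - s L)], so multiplying by [18 lambda^2] gives [2
       (9 lambda^2 V) - 9 H2 <= 8 H2 - 9 H2 < 0]. *)
    have l2 : 0 < 18 * lambda ^+ 2 by rewrite mulr_gt0// exprn_gt0.
    rewrite -(pmulr_rlt0 _ l2) CV Ibs.
    set B := (X in X - _ + _).
    have {}h2E : H2 = L * beta - 2 * s * B + s ^+ 2 * L := h2E.
    have -> : 18 * lambda ^+ 2 * (B - s * L + V) = 2 * (9 * lambda ^+ 2 * V) - 9 * H2.
      by rewrite h2E betaE sE; ring.
    by lra.
  by move: CL; rewrite pmulr_llt0// sE; lra.
rewrite /minimal_speed; case: xgetP => [c _ [_ clb]|_]; last by rewrite mulr_gt0.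
by apply: le_lt_trans speed_lt; apply: clb; exists lambda.
Qed.
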